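(* A bitopological space $(X,\tau_1,\tau_2)$ is pairwise nearly Lindelöf if and only if its pairwise semiregularization $(X,\tau^s_{(1,2)},\tau^s_{(2,1)})$ is pairwise nearly Lindelöf.
   Context: A bitopological space $(X,\tau_1,\tau_2)$ is a set $X$ with two topologies (no separation axioms assumed). For a topology $\sigma$ on $X$, $\sigma\text{-}\mathrm{int}$ and $\sigma\text{-}\mathrm{cl}$ denote interior and closure with respect to $\sigma$. For $i\ne j$ in $\{1,2\}$, a set $S\subseteq X$ is $(\tau_i,\tau_j)$-regular open if $\tau_i\text{-}\mathrm{int}(\tau_j\text{-}\mathrm{cl}(S))=S$. The topology on $X$ generated by the $(\tau_i,\tau_j)$-regular open sets (they are closed under finite intersections and form a base for it) is denoted $\tau^s_{(i,j)}$; the space $(X,\tau^s_{(1,2)},\tau^s_{(2,1)})$ is the pairwise semiregularization of $(X,\tau_1,\tau_2)$. For two topologies $\sigma,\sigma'$ on $X$, the space is $(\sigma,\sigma')$-nearly Lindelöf if for every cover $\{U_\alpha:\alpha\in\Delta\}$ of $X$ by $\sigma$-open sets there is a countable subset $\{\alpha_n:n\in\mathbb{N}\}$ of $\Delta$ with $X=\bigcup_{n\in\mathbb{N}}\sigma\text{-}\mathrm{int}(\sigma'\text{-}\mathrm{cl}(U_{\alpha_n}))$. A bitopological space $(X,\sigma_1,\sigma_2)$ is pairwise nearly Lindelöf if it is both $(\sigma_1,\sigma_2)$-nearly Lindelöf and $(\sigma_2,\sigma_1)$-nearly Lindelöf. *)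

(* Defs.v *)
From HB Require Import structures.
From mathcomp Require Import all_boot all_classical topology.

Set Implicit Arguments.
Unset Strict Implicit.
Unset Printing Implicit Defensive.

Local Open Scope classical_set_scope.

(* A topology on X is an inhabitant of [Topological X], so that several of them
   can live on the same carrier (as in the library's [sup_topology]). *)

Definition open_in (X : Type) (t : Topological X) : set X -> Prop :=
  @open (Topological.Pack t).

Definition int_in (X : Type) (t : Topological X) : set X -> set X :=
  @interior (Topological.Pack t).

Definition cl_in (X : Type) (t : Topological X) : set X -> set X :=
  @closure (Topological.Pack t).

Definition regular_open (X : Type) (ti tj : Topological X) : set (set X) :=
  [set S | int_in ti (cl_in tj S) = S].

Definition semireg_space (X : Type) (ti tj : Topological X) : Type := X.

HB.instance Definition _ (X : Type) (ti tj : Topological X) :=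
  Choice.copy (semireg_space ti tj) (Topological.Pack ti).

(* The regular open sets are only declared as a subbase, which needs no proof;
   they are in fact closed under finite intersections. *)
HB.instance Definition _ (X : Type) (ti tj : Topological X) :=
  isSubBaseTopological.Build (semireg_space ti tj) (regular_open ti tj) id.

Definition semireg (X : Type) (ti tj : Topological X) : Topological X :=
  Topological.class (semireg_space ti tj).

(* Covers are indexed families; a countable subset of the index type may be
   finite or empty, the latter being relevant only when X is empty. *)
Definition nearly_lindelof (X : Type) (s s' : Topological X) : Prop :=
  forall (I : Type) (U : I -> set X),
    (forall a, open_in s (U a)) -> \bigcup_a U a = setT ->
    exists2 D : set I, countable D &
      \bigcup_(a in D) int_in s (cl_in s' (U a)) = setT.

Definition pairwise_nearly_lindelof (X : Type) (s1 s2 : Topological X) : Prop :=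
  nearly_lindelof s1 s2 /\ nearly_lindelof s2 s1.

(* Main.v *)
Require Import Defs.
From mathcomp Require Import all_boot all_classical topology.

(** The regularized set [V = t1-int (t2-cl U)] of a [t1]-open set [U] contains
    [U] and is regular open, hence open in [semireg t1 t2], while taking
    [t1-int (t2-cl _)] of [V] gives [V] back.  Everything rests on one identity
    ([int_cl_semireg]): on [t1]-open sets, the operator [int (cl _)] computed in
    the pairwise semiregularization agrees with the one computed in the original
    space.  For closures this holds because a [t2]-open set missing [U] can be
    enlarged to a regular open one that still misses [U] ([cl_semireg]); for
    interiors, because the [t1]-interior of a [t2]-closure of a [t1]-open set is
    already open in the semiregularization.

    Given the identity, a cover by [semireg t1 t2]-open sets is a cover by
    [t1]-open sets, and a countable subfamily good for the latter is good for the
    former.  Conversely a cover by [t1]-open sets [U a] is enlarged to the cover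
    by the sets [t1-int (t2-cl (U a))], which are fixed by [int (cl _)], so that a
    countable subfamily good for the enlarged cover is good for the original
    one. *)

Set Implicit Arguments.
Unset Strict Implicit.
Unset Printing Implicit Defensive.

Local Open Scope classical_set_scope.

Section OneTopology.
Context (X : Type) (t : Topological X).
Implicit Types A B : set X.

Lemma open_int_in A : open_in t (int_in t A).
Proof. exact: (@open_interior (Topological.Pack t)). Qed.

Lemma int_in_sub A : int_in t A `<=` A.
Proof. exact: (@interior_subset (Topological.Pack t)). Qed.

Lemma int_in_max A B : open_in t A -> A `<=` B -> A `<=` int_in t B.
Proof.
move=> oA AB x Ax.
exact: (@filterS _ _ (nbhs_filter (x : Topological.Pack t)) A) (open_nbhs_nbhs _).
Qed.

Lemma cl_in_sup A : A `<=` cl_in t A.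
Proof. exact: (@subset_closure (Topological.Pack t)). Qed.

Lemma cl_in_meets A B x : open_in t B -> B x -> cl_in t A x -> A `&` B !=set0.
Proof.
move=> oB Bx; apply.
by apply: (@open_nbhs_nbhs (Topological.Pack t)).
Qed.

Lemma not_cl_in A x : ~ cl_in t A x ->
  exists B, [/\ open_in t B, B x & A `&` B = set0].
Proof.
move=> nAx; exists (~` cl_in t A); split=> //.
  exact: (@closed_openC (Topological.Pack t) _ (@closed_closure (Topological.Pack t) A)).
by apply/seteqP; split=> // y [/cl_in_sup].
Qed.

End OneTopology.

Section Semiregularization.
Context (X : Type) (t1 t2 : Topological X).
Implicit Types A U : set X.

(** Put [V = t1-int (t2-cl A)].  Then [V `<=` t2-cl A] gives
    [t2-cl V `<=` t2-cl A], hence [t1-int (t2-cl V) `<=` V]; conversely [V] is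
    [t1]-open and contained in [t2-cl V]. *)
Lemma regular_open_int_cl A : regular_open t1 t2 (int_in t1 (cl_in t2 A)).
Proof.
rewrite /regular_open /=; set V := int_in t1 (cl_in t2 A).
have oV : open_in t1 V by exact: open_int_in.
apply/seteqP; split; last exact: (int_in_max oV (@cl_in_sup _ _ _)).
apply: int_in_max; first exact: open_int_in.
apply: subset_trans (@int_in_sub _ _ _) _.
move=> x clVx; apply: contrapT => nclx.
have [B [oB Bx AB0]] := not_cl_in nclx.
have [y [Vy By]] := cl_in_meets oB Bx clVx.
have clAy : cl_in t2 A y by exact: int_in_sub Vy.
by have := cl_in_meets oB By clAy; rewrite AB0 => -[].
Qed.

Lemma open_sub_int_cl U : open_in t1 U -> U `<=` int_in t1 (cl_in t2 U).
Proof. by move=> oU; exact: (int_in_max oU (@cl_in_sup _ _ _)). Qed.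

Lemma regular_open_semireg A :
  regular_open t1 t2 A -> open_in (semireg t1 t2) A.
Proof.
move=> rA; exists [set A]; last by rewrite bigcup_set1.
by move=> _ ->; exact: (@finI_from1 _ _ _ id).
Qed.

(** Regular open sets are [t1]-open, being [t1]-interiors; finite intersections
    and unions of them remain so. *)
Lemma semireg_open_in A : open_in (semireg t1 t2) A -> open_in t1 A.
Proof.
case=> D DI <-; apply: (@bigcup_open (Topological.Pack t1)) => B /DI[F FR <-].
rewrite bigcap_fset big_seq; apply: big_ind.
- exact: (@openT (Topological.Pack t1)).
- exact: (@openI (Topological.Pack t1)).
- by move=> S /FR/set_mem/= <-; exact: open_int_in.
Qed.

End Semiregularization.

(** The semiregularized topology is coarser, so its closure is larger.
    Conversely, a [t2]-open set [B] missing the [t1]-open set [U] has its [t1]-closure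
    missing [U], so [t2-int (t1-cl B)] is a regular open set that separates the
    points of [B] from [U]. *)
Lemma cl_semireg (X : Type) (t1 t2 : Topological X) (U : set X) :
  open_in t1 U -> cl_in (semireg t2 t1) U = cl_in t2 U.
Proof.
move=> oU; apply/seteqP; split=> x; last first.
  move=> clUx; apply: contrapT => nclx.
  have [B [/semireg_open_in oB Bx UB0]] := not_cl_in nclx.
  by have := cl_in_meets oB Bx clUx; rewrite UB0 => -[].
move=> clUx; apply: contrapT => nclx.
have [B [oB Bx UB0]] := not_cl_in nclx.
have oW := regular_open_semireg (regular_open_int_cl t2 t1 B).
have [y [Uy Wy]] := cl_in_meets oW (open_sub_int_cl t1 oB Bx) clUx.
have clBy : cl_in t1 B y by exact: int_in_sub Wy.
by have := cl_in_meets oU Uy clBy; rewrite setIC UB0 => -[].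
Qed.

Lemma int_cl_semireg (X : Type) (t1 t2 : Topological X) (U : set X) :
  open_in t1 U ->
  int_in (semireg t1 t2) (cl_in (semireg t2 t1) U) = int_in t1 (cl_in t2 U).
Proof.
move=> oU; rewrite cl_semireg //; apply/seteqP; split.
  apply: int_in_max; last exact: int_in_sub.
  exact/semireg_open_in/open_int_in.
apply: int_in_max; last exact: int_in_sub.
exact/regular_open_semireg/regular_open_int_cl.
Qed.

Lemma nearly_lindelof_semireg (X : Type) (t1 t2 : Topological X) :
  nearly_lindelof t1 t2 <->
  nearly_lindelof (semireg t1 t2) (semireg t2 t1).
Proof.
split=> L I U oU coverU.
  have oU1 a : open_in t1 (U a) := semireg_open_in (oU a).
  have [D cD coverD] := L I U oU1 coverU.
  exists D => //; rewrite -coverD.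
  by apply: eq_bigcupr => a _; exact: int_cl_semireg.
pose V a := int_in t1 (cl_in t2 (U a)).
have oV a : open_in (semireg t1 t2) (V a).
  exact/regular_open_semireg/regular_open_int_cl.
have coverV : \bigcup_a V a = setT.
  apply/seteqP; split=> // x _.
  have [a _ Uax] : (\bigcup_a U a) x by rewrite coverU.
  by exists a => //; exact: open_sub_int_cl.
have [D cD coverD] := L I V oV coverV.
exists D => //; rewrite -coverD; apply: eq_bigcupr => a _.
rewrite int_cl_semireg; last exact: open_int_in.
by rewrite (regular_open_int_cl t1 t2 (U a)).
Qed.

Theorem corollary4p3 (X : Type) (t1 t2 : Topological X) :
  pairwise_nearly_lindelof t1 t2 <->
  pairwise_nearly_lindelof (semireg t1 t2) (semireg t2 t1).
Proof.
have [to12 from12] := nearly_lindelof_semireg t1 t2.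
have [to21 from21] := nearly_lindelof_semireg t2 t1.
split=> -[L12 L21]; split.
- exact: to12.
- exact: to21.
- exact: from12.
- exact: from21.
Qed.
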